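(* Let $n\ge 1$, let $(g_{jl})_{1\le j,l\le n}$ be weights and $c_1,\dots,c_n\in\mathbb{C}$, and consider the network iteration on $\mathbb{C}^n$ given by $z_j(k+1)=\left(\sum_{l=1}^n g_{jl}z_l(k)\right)^2+c_j$, $1\le j\le n$, $k\ge 0$. Suppose that $|g_{jj}|>\sum_{l\ne j}|g_{jl}|$ for all $1\le j\le n$. Then the network has an escape radius depending on the network weights (and node parameters): there exists $R>0$, depending only on $(g_{jl})$ and $(c_j)$, such that for every multi-orbit $(z_1(k),\dots,z_n(k))_{k\ge 0}$ of the network, if $|z_j(k)|>R$ for some node $j$ and some step $k\ge 0$, then $\max_{1\le l\le n}|z_l(t)|\to\infty$ as $t\to\infty$.
   Context: The numbers $g_{jl}\in\mathbb{C}$ are the weights of the oriented edges of the network's underlying graph (from node $l$ into node $j$), with $g_{jl}=0$ when there is no such edge; each node $j$ in isolation iterates the quadratic map $z\mapsto z^2+c_j$. A multi-orbit is the sequence in $\mathbb{C}^n$ obtained by iterating the network from an arbitrary initial condition $(z_1(0),\dots,z_n(0))\in\mathbb{C}^n$. An escape radius is a number $R>0$ such that once the state has some component of modulus larger than $R$, the multi-orbit tends to infinity in the maximum norm. *)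

(* Defs.v *)
From HB Require Import structures.
From mathcomp Require Import all_boot all_order all_algebra.
From mathcomp Require Import all_classical all_reals all_analysis.
From mathcomp Require Import complex.

Set Implicit Arguments.
Unset Strict Implicit.
Unset Printing Implicit Defensive.

Import Order.TTheory GRing.Theory Num.Theory.
Import numFieldNormedType.Exports.

Local Open Scope classical_set_scope.
Local Open Scope ring_scope.
Local Open Scope complex_scope.

(* The complex numbers are [R[i]] for [R : realType]; [cmod] is the R-valued
   modulus, as opposed to [`|z|], which lives in [R[i]]. *)
Notation cmod := Normc.normc.

(* [g j l] is the weight of the edge from node [l] into node [j]. *)
Definition network_step (R : realType) (n : nat) (g : 'M[R[i]]_n)
    (c z : 'cV[R[i]]_n) : 'cV[R[i]]_n :=
  \col_j ((\sum_(l < n) g j l * z l 0) ^+ 2 + c j 0).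

Definition multi_orbit (R : realType) (n : nat) (g : 'M[R[i]]_n)
    (c : 'cV[R[i]]_n) (z : nat -> 'cV[R[i]]_n) : Prop :=
  forall k, z k.+1 = network_step g c (z k).

Definition max_modulus (R : realType) (n : nat) (z : 'cV[R[i]]_n) : R :=
  \big[Num.max/0]_(l < n) cmod (z l 0).

Definition escape_radius (R : realType) (n : nat) (g : 'M[R[i]]_n)
    (c : 'cV[R[i]]_n) (r : R) : Prop :=
  0 < r /\
  forall z : nat -> 'cV[R[i]]_n, multi_orbit g c z ->
    forall (j : 'I_n) (k : nat), r < cmod (z k j 0) ->
      max_modulus (z t) @[t --> \oo] --> +oo.

(* Main.v *)
(* Diagonal dominance gives d > 0 with |g_jj| - sum_(l != j) |g_jl| >= d for
   every j.  At a node j of largest modulus M the reverse triangle inequality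
   bounds the input |sum_l g_jl z_l| below by d M, so one step changes M into at
   least d^2 M^2 - C, where C bounds the |c_j|.  This exceeds M + 1 as soon as
   M > 1 + (2 + C) / d^2, so M grows at least linearly from then on. *)

Require Import Defs.
From HB Require Import structures.
From mathcomp Require Import all_boot all_order all_algebra.
From mathcomp Require Import all_classical all_reals all_analysis.
From mathcomp Require Import complex.
From mathcomp Require Import lra.

Set Implicit Arguments.
Unset Strict Implicit.
Unset Printing Implicit Defensive.

Import Order.TTheory GRing.Theory Num.Theory.
Import numFieldNormedType.Exports.

Local Open Scope classical_set_scope.
Local Open Scope ring_scope.
Local Open Scope complex_scope.

Section ComplexModulus.
Variable R : realType.
Implicit Types x y : R[i].

Lemma cmod_ge0 x : 0 <= cmod x.
Proof. by case: x => a b; exact: sqrtr_ge0. Qed.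

Lemma cmod_reverse_triangle x y : cmod x - cmod y <= cmod (x + y).
Proof.
have := @le_normcD R (x + y) (- y).
by rewrite addrK normcN lerBlDr.
Qed.

Lemma cmod_sum (I : finType) (P : pred I) (F : I -> R[i]) :
  cmod (\sum_(i | P i) F i) <= \sum_(i | P i) cmod (F i).
Proof.
elim/big_ind2: _ => [|a x b y xa yb|//]; first by rewrite Normc.normc0.
exact: le_trans (le_normcD x y) (lerD xa yb).
Qed.

End ComplexModulus.

Section Network.
Variables (R : realType) (n : nat) (g : 'M[R[i]]_n) (c : 'cV[R[i]]_n).
Implicit Type z : 'cV[R[i]]_n.

Lemma cmod_le_max_modulus z j : cmod (z j 0) <= max_modulus z.
Proof. exact: (le_bigmax _ (fun l => cmod (z l 0))). Qed.

Lemma max_modulus_ge0 z : 0 <= max_modulus z.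
Proof. exact: bigmax_ge_id. Qed.

Lemma max_modulus_attained z (i : 'I_n) :
  exists j, max_modulus z = cmod (z j 0).
Proof.
(* The node [i] shows that the index set is inhabited; moduli being nonnegative, the default 0 never
   exceeds an actual entry. *)
by eexists; apply: (bigmax_eq_arg 0 i) => // l _; exact: cmod_ge0.
Qed.

Lemma diagonal_dominance_gap :
    (forall j, \sum_(l < n | l != j) cmod (g j l) < cmod (g j j)) ->
  exists2 d : R, 0 < d &
    forall j, d <= cmod (g j j) - \sum_(l < n | l != j) cmod (g j l).
Proof.
(* The least of finitely many positive gaps; the default 1 keeps it positive even over an empty
   index set. *)
move=> hg; exists (\big[Num.min/1]_(j < n)
  (cmod (g j j) - \sum_(l < n | l != j) cmod (g j l))).
  by apply: lt_bigmin => // j _; rewrite subr_gt0.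
move=> j; exact: (bigmin_le _ j (fun j =>
  cmod (g j j) - \sum_(l < n | l != j) cmod (g j l))).
Qed.

(** Since [j] attains the maximum M, the diagonal term has modulus exactly |g_jj| M, while each
    other term is at most |g_jl| M. *)
Lemma input_ge z j : cmod (z j 0) = max_modulus z ->
  (cmod (g j j) - \sum_(l < n | l != j) cmod (g j l)) * max_modulus z
    <= cmod (\sum_(l < n) g j l * z l 0).
Proof.
move=> zj; rewrite [in leRHS](bigD1 j) //=.
apply: le_trans (cmod_reverse_triangle _ _).
rewrite mulrBl Normc.normcM zj lerB // (le_trans (cmod_sum _ _)) // mulr_suml.
by apply: ler_sum => l _; rewrite Normc.normcM ler_wpM2l ?cmod_ge0
  ?cmod_le_max_modulus.
Qed.

Lemma max_modulus_network_step_ge z (d : R) :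
    0 <= d ->
    (forall j, d <= cmod (g j j) - \sum_(l < n | l != j) cmod (g j l)) ->
    (0 < n)%N ->
  (d * max_modulus z) ^+ 2 - max_modulus c <= max_modulus (network_step g c z).
Proof.
move=> d0 hd n0.
have [j zj] := max_modulus_attained z (Ordinal n0).
apply: le_trans (cmod_le_max_modulus _ j); rewrite mxE.
apply: le_trans (cmod_reverse_triangle _ _).
apply: lerB (cmod_le_max_modulus _ _).
rewrite [in leRHS]expr2 Normc.normcM -expr2 lerXn2r ?nnegrE ?cmod_ge0 //.
  by rewrite mulr_ge0 ?max_modulus_ge0.
apply: le_trans (input_ge (esym zj)).
by rewrite ler_wpM2r ?max_modulus_ge0.
Qed.

End Network.

(** Each increase by 1 keeps [u] above [r], so the hypothesis applies again: from step [k] on, [u]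
    dominates a sequence of slope 1. *)
Lemma cvgy_of_increment (R : realType) (u : nat -> R) (r : R) (k : nat) :
    (forall t, r < u t -> u t + 1 <= u t.+1) -> r < u k ->
  u t @[t --> \oo] --> +oo.
Proof.
move=> hu rk.
have ge_t t : u k + t%:R <= u (t + k)%N.
  elim: t => [|t IH]; first by rewrite addr0.
  rewrite addSn -natr1 addrA (le_trans _ (hu _ _)) ?lerD2r //.
  by rewrite (lt_le_trans rk) // (le_trans _ IH) // lerDl.
rewrite -(cvg_shiftn k); apply: (ger_cvgy (f := fun t => u k + t%:R)).
  exact: nearW.
apply/cvgryPge => A; near=> t.
rewrite -lerBlDl; near: t.
by have /cvgryPge := @cvgr_idn R; exact.
Unshelve. all: by end_near.
Qed.

Theorem theorem2p2 (R : realType) (n : nat) (hn : (1 <= n)%N)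
    (g : 'M[R[i]]_n) (c : 'cV[R[i]]_n)
    (hg : forall j : 'I_n, \sum_(l < n | l != j) cmod (g j l) < cmod (g j j)) :
  exists r : R, escape_radius g c r.
Proof.
have [d d0 hd] := diagonal_dominance_gap hg.
set C := max_modulus c.
have C0 : 0 <= C := max_modulus_ge0 c.
have q0 : 0 <= (2 + C) / d ^+ 2 by rewrite divr_ge0 ?sqr_ge0 ?addr_ge0.
exists (1 + (2 + C) / d ^+ 2); split=> [|z hz j k rk]; first by rewrite ltr_pwDl.
apply: (@cvgy_of_increment _ _ (1 + (2 + C) / d ^+ 2) k) => [t|]; last first.
  exact: lt_le_trans rk (cmod_le_max_modulus _ _).
rewrite hz => rM.
apply: le_trans (max_modulus_network_step_ge _ _ (ltW d0) hd hn).
set M := max_modulus (z t) in rM *.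
(* The two summands of the radius serve separately: 1 gives [M1], and the quotient gives [dM]. *)
have M1 : 1 < M by rewrite (le_lt_trans _ rM) // lerDl.
have dM : 2 + C <= d ^+ 2 * M.
  rewrite mulrC -ler_pdivrMr ?exprn_gt0 // ltW // (le_lt_trans _ rM) //.
  by rewrite lerDr.
have : (2 + C) * M <= (d * M) ^+ 2.
  by rewrite exprMn [M ^+ 2]expr2 mulrA ler_wpM2r // ltW // (lt_trans _ M1).
(* (2 + C) M - C - (M + 1) = (1 + C)(M - 1), which is nonnegative by [C0] and [M1]. *)
by rewrite -/C; nra.
Qed.
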